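(* Let $G$ be a finite reflexive graph. Then $G$ is a strong cocomparability graph if and only if $G$ does not contain a weak edge-asteroid.
   Context: All graphs are finite and simple apart from loops. A graph is reflexive if every vertex carries a loop; its edge set $E(G)$ contains all loops $vv$, and an ''edge'' $uu'$ may be a loop ($u=u'$). A walk $u_0u_1\dots u_t$ ($t\ge 1$) in $G$ is a sequence of vertices with $u_ju_{j+1}\in E(G)$ for all $j$ (consecutive vertices may coincide, since loops are edges); its edges are $u_ju_{j+1}$, $0\le j<t$. The Slash matrix is the $2\times 2$ matrix with rows $(0,1)$ and $(1,0)$. A matrix contains the Slash matrix as a submatrix if there are rows $i<j$ and columns $k<l$ with entries $(i,k)=0$, $(i,l)=1$, $(j,k)=1$, $(j,l)=0$. A symmetric ordering of a square matrix is obtained by applying the same permutation to rows and columns. A reflexive graph is a strong cocomparability graph if its adjacency matrix (with 1's on the diagonal) has a symmetric ordering not containing the Slash matrix as a submatrix. For edges $uu'$, $vv'$ of a reflexive graph $G$ with $\{u,u'\}\cap\{v,v'\}=\emptyset$, $uu'$ avoids $vv'$ if one of the following holds: (i) $u=u'$, $v=v'$, $uv\notin E(G)$; (ii) $u=u'$, $v\ne v'$, $uv\notin E(G)$ and $uv'\notin E(G)$; (iii) $u\ne u'$, $v=v'$, $uv\notin E(G)$ and $u'v\notin E(G)$; (iv) $u\ne u'$, $v\ne v'$, and $\{u,u',v,v'\}$ induces a $2K_2$, a $P_4$, or a $C_4$ in $G$. (Equivalently: the two edges are vertex-disjoint, each of $u,u'$ has a non-neighbour in $\{v,v'\}$ and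 each of $v,v'$ has a non-neighbour in $\{u,u'\}$.) An edge avoids a walk if it avoids every edge of the walk. A weak edge-asteroid in $G$ is a set of edges $x_0y_0,x_1y_1,\dots,x_{2k}y_{2k}$ ($k\ge 1$) such that for each $i=0,\dots,2k$, the edge $x_iy_i$ avoids some walk whose first edge is $x_{i+k}y_{i+k}$ and whose last edge is $x_{i+k+1}y_{i+k+1}$ (subscripts modulo $2k+1$). *)

(* Defs.v *)
From mathcomp Require Import all_boot all_algebra.
Set Implicit Arguments. Unset Strict Implicit. Unset Printing Implicit Defensive.

Section ReflexiveGraphs.
Variables (T : finType) (e : rel T).

Definition contains_slash m n (A : 'M[bool]_(m, n)) : Prop :=
  exists (i j : 'I_m) (k l : 'I_n),
    [/\ i < j, k < l,
        A i k = false, A i l = true &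
        A j k = true /\ A j l = false].

Definition ordered_adj_matrix (s : 'I_#|T| -> T) : 'M[bool]_#|T| :=
  \matrix_(i, j) e (s i) (s j).

Definition strong_cocomparability : Prop :=
  exists s : 'I_#|T| -> T, bijective s /\ ~ contains_slash (ordered_adj_matrix s).

(* Edge uu' avoids edge vv' (cases (i)-(iv) of the definition). In case (iv)
   the four vertices are distinct, uu' and vv' are edges, and the induced
   subgraph is a 2K2 (no edge between {u,u'} and {v,v'}), a P4 (exactly one
   such edge) or a C4 (exactly two such edges, forming a perfect matching). *)
Definition induces_2K2_P4_C4 (u u' v v' : T) : bool :=
  let a := e u v in let b := e u v' in let c := e u' v in let d := e u' v' in
  e u u' && e v v' &&
  [|| ~~ a && ~~ b && ~~ c && ~~ d,
      (a + b + c + d == 1)%N,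
      a && d && ~~ b && ~~ c | b && c && ~~ a && ~~ d].

Definition avoids (u u' v v' : T) : bool :=
  [&& u != v, u != v', u' != v, u' != v' &
   if u == u' then
     (if v == v' then ~~ e u v
      else ~~ e u v && ~~ e u v')
   else
     (if v == v' then ~~ e u v && ~~ e u' v
      else induces_2K2_P4_C4 u u' v v')].

(* A walk u_0 u_1 ... u_t (t >= 1) is represented by its first vertex w0 and
   the nonempty list ws = [u_1; ...; u_t]; its edges are the pairs (u_j,u_{j+1}). *)
Definition is_walk (w0 : T) (ws : seq T) : bool := (ws != [::]) && path e w0 ws.

Definition walk_edges (w0 : T) (ws : seq T) : seq (T * T) := zip (w0 :: ws) ws.

Definition same_edge (p : T * T) (x y : T) : bool := (p == (x, y)) || (p == (y, x)).

Definition avoids_walk (u u' w0 : T) (ws : seq T) : bool :=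
  all (fun p => avoids u u' p.1 p.2) (walk_edges w0 ws).

Definition weak_edge_asteroid (k : nat) (x y : nat -> T) : Prop :=
  (1 <= k)%N /\
  (forall i, (i < k.*2.+1)%N -> e (x i) (y i)) /\
  (forall i, (i < k.*2.+1)%N ->
     let j1 := ((i + k) %% k.*2.+1)%N in
     let j2 := ((i + k + 1) %% k.*2.+1)%N in
     exists (w0 : T) (ws : seq T),
       [/\ is_walk w0 ws,
           same_edge (head (w0, w0) (walk_edges w0 ws)) (x j1) (y j1),
           same_edge (last (w0, w0) (walk_edges w0 ws)) (x j2) (y j2) &
           avoids_walk (x i) (y i) w0 ws]).

Definition has_weak_edge_asteroid : Prop :=
  exists (k : nat) (x y : nat -> T), weak_edge_asteroid k x y.

End ReflexiveGraphs.

(* Main.v *)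
Require Import Defs.
From mathcomp Require Import all_boot all_algebra.
From mathcomp Require Import zify.
Set Implicit Arguments. Unset Strict Implicit. Unset Printing Implicit Defensive.

(* Call (x, y) forced by (a, b) when ax, by are edges and ay, bx are not: an
   ordering is Slash-free iff {(a, b) | a < b} is closed under this symmetric
   relation, and two disjoint edges avoid each other iff their ends can be
   matched so that one pair forces the other.

   If the ordering exists, compare edges by their smaller ends: an edge lies on
   one side of any walk it avoids, which is contradictory around an odd cycle.
   Conversely, if a forcing walk leads from (a, b) to (b, a), its two coordinates
   concatenate to a closed walk of 2n edges whose consecutive edges, with the
   first one repeated, form a weak edge-asteroid of 2n + 1 edges.

   It remains to find an ordering when no class of the forcing equivalence
   contains two opposite pairs. Take a maximal acyclic union D of classes. A
   directed triangle on classes no two of which are opposite keeps its third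
   vertex when one of its arcs makes an even number of forcing steps
   (circuit_ev). Hence D is transitive, and if the class A of a pair is
   undecided, a shortest cycle of D + A has the form A A D or A D A D; such cycles
   cannot exist for both A and its opposite. So D decides all the pairs that are
   subject to some constraint, and any linear extension of D is Slash-free. *)

(** * Shortcuts in cycles and linear extensions of finite relations *)

Lemma cycle_shortcut (T : eqType) (R : rel T) (c : seq T) : irreflexive R ->
  cycle R c -> c != [::] ->
  (forall f : nat -> T, (forall i, R (f i) (f i.+1)) -> exists i, R (f i) (f i.+2)) -> False.
Proof.
move=> irrR cyc_c c_neq0 short.
have [n] := ubnP (size c); elim: n c cyc_c c_neq0 => // n IHn [//|x0 c0] cyc_c _ sz_c.
(* [c i] is the cycle rotated [i] times, so [f] runs around it forever. A shortcut of [f] removes a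
   vertex from a rotated cycle; on one or two vertices it would be a loop. *)
pose c i := iter i (rot 1) (x0 :: c0); pose f i := head x0 (c i).
have cyc i : cycle R (c i) by elim: i => //= i IHi; rewrite rot_cycle.
have szc i : size (c i) = (size c0).+1 by elim: i => //= i <-; rewrite size_rot.
have cS i : c i.+1 = rot 1 (c i) by rewrite /c iterS.
have fS i : R (f i) (f i.+1).
  move: (cyc i) (szc i); rewrite /f cS.
  by case: (c i) => [|x [|y s]] //; rewrite rot1_cons //= => /andP[].
have [i] := short f fS.
move: (cyc i) (szc i); rewrite /f !cS.
case: (c i) => [|x [|y [|z s]]] //; rewrite ?rot1_cons.
- by rewrite /= irrR.
- by rewrite /= irrR.
rewrite /= => /and3P[_ _ zs] szs xz.
apply: (IHn [:: x, z & s]); rewrite /= ?xz //.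
by move: sz_c; rewrite /= -[size c0]/(size c0).+1.-1 -szs.
Qed.

Definition arc_of (T : finType) (D : {set T * T}) : rel T := fun x y => (x, y) \in D.
Definition acyclic (T : finType) (D : {set T * T}) := [forall p in D, ~~ connect (arc_of D) p.2 p.1].

Lemma acyclicP (T : finType) (D : {set T * T}) :
  reflect (forall x y, (x, y) \in D -> ~~ connect (arc_of D) y x) (acyclic D).
Proof.
apply: (iffP forall_inP) => [acD x y|acD [x y]]; first by move/acD.
exact: acD.
Qed.

(** Sort by the number of predecessors, break ties by [enum_rank], and let [r] be the position in
    this order. *)
Lemma linear_extension (T : finType) (D : {set T * T}) : transitive (arc_of D) -> irreflexive (arc_of D) ->
  exists2 r : T -> 'I_#|T|, injective r & forall x y, arc_of D x y -> r x < r y.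
Proof.
move=> trD irrD; pose d x := #|[set y | arc_of D y x]|.
pose k x := d x * #|T|.+1 + enum_rank x.
have k_inj : injective k.
  move=> x y kxy; apply/enum_rank_inj/val_inj => /=.
  by have := congr1 (modn^~ #|T|.+1) kxy; rewrite /k !modnMDl !modn_small // ltnS ltnW.
have kD x y : arc_of D x y -> k x < k y.
  move=> xy; have : d x < d y.
    apply: proper_card; apply/properP; split.
      by apply/subsetP => z; rewrite !inE => /trD; apply.
    by exists x; rewrite inE ?irrD.
  move=> dxy; apply: leq_trans (leq_addr _ _); apply: leq_trans (leq_mul dxy (leqnn _)).
  by rewrite /k mulSn -addnS [leqRHS]addnC leq_add2l ltnS ltnW.
pose s x := [set y | k y < k x].
have s_lt x y : k x < k y -> #|s x| < #|s y|.
  move=> kxy; apply: proper_card; apply/properP; split.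
    by apply/subsetP => z; rewrite !inE => /ltn_trans; apply.
  by exists x; rewrite inE ?ltnn.
have sT x : #|s x| < #|T|.
  apply: proper_card; apply/properP; split; first exact/subsetP.
  by exists x; rewrite ?inE ?ltnn.
exists (fun x => Ordinal (sT x)) => [x y [sxy]|x y /kD/s_lt //].
apply: k_inj; case: (ltngtP (k x) (k y)) => // /s_lt; by rewrite sxy ltnn.
Qed.

(** * The forcing relation, its classes and circuits *)

Section Forcing.
Variables (T : finType) (e : rel T).
Hypothesis e_sym : symmetric e.

Definition rev_pair (p : T * T) := (p.2, p.1).

Definition force : rel (T * T) := fun p q =>
  [&& e p.1 q.1, e p.2 q.2, ~~ e p.1 q.2 & ~~ e p.2 q.1].

Definition force2 : rel (T * T) := fun p q => [exists r, force p r && force r q].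

Definition cl := connect force.
(* Parity matters: by circuit_ev only an even number of steps fixes the third
   vertex of a triangle. *)
Definition ev := connect force2.
Definition forced p := [exists q, force p q].

Lemma force_sym : symmetric force.
Proof.
move=> [a b] [c d]; rewrite /force /=.
by rewrite (e_sym a c) (e_sym b d) (e_sym a d) (e_sym b c) andbA [RHS]andbA [in RHS](andbC (~~ e c b)).
Qed.

Lemma force_rev p q : force (rev_pair p) (rev_pair q) = force p q.
Proof. by rewrite /force /= andbCA andbA [in RHS]andbA (andbC (~~ _)) (andbC (e p.1 _)). Qed.

Lemma force2_sym : symmetric force2.
Proof.
by move=> p q; apply/existsP/existsP=> -[r] /andP[pr rq]; exists r;
  rewrite force_sym rq force_sym.
Qed.

Lemma force2I p q r : force p r -> force r q -> force2 p q.
Proof. by move=> pr rq; apply/existsP; exists r; rewrite pr. Qed.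

Lemma cl_refl p : cl p p. Proof. exact: connect0. Qed.
Lemma cl_sym : symmetric cl.
Proof. exact/sym_connect_sym/force_sym. Qed.
Lemma ev_sym : symmetric ev.
Proof. exact/sym_connect_sym/force2_sym. Qed.
Lemma cl_trans : transitive cl. Proof. exact: connect_trans. Qed.
Lemma ev_trans : transitive ev. Proof. exact: connect_trans. Qed.
Lemma force_cl p q : force p q -> cl p q. Proof. exact: connect1. Qed.
Lemma force2_ev p q : force2 p q -> ev p q. Proof. exact: connect1. Qed.

Lemma ev_cl p q : ev p q -> cl p q.
Proof.
apply: connect_sub => {p q}p q /existsP[r /andP[pr rq]].
exact: cl_trans (force_cl pr) (force_cl rq).
Qed.

Lemma ev_rev p q : ev (rev_pair p) (rev_pair q) = ev p q.
Proof.
have sub p' q' : ev p' q' -> ev (rev_pair p') (rev_pair q').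
  move=> /connectP[s]; elim: s p' => [|r s IHs] p' /=; first by move=> _ ->; apply: connect0.
  move=> /andP[/existsP[t /andP[pt tr]] rs] Dq; apply: ev_trans (IHs _ rs Dq).
  by apply/force2_ev/(@force2I _ _ (rev_pair t)); rewrite force_rev.
apply/idP/idP=> [|/sub//]; move/sub; by case: p q => [a b] [c d].
Qed.

Lemma cl_rev p q : cl (rev_pair p) (rev_pair q) = cl p q.
Proof.
have sub p' q' : cl p' q' -> cl (rev_pair p') (rev_pair q').
  move=> /connectP[s]; elim: s p' => [|r s IHs] p' /=; first by move=> _ ->; apply: connect0.
  by move=> /andP[pr rs] Dq; apply: cl_trans (IHs _ rs Dq); rewrite force_cl ?force_rev.
apply/idP/idP=> [|/sub//]; move/sub; by case: p q => [a b] [c d].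
Qed.

Lemma cl_ev p q : cl p q -> ev p q \/ exists2 r, force p r & ev r q.
Proof.
move=> /connectP[s]; elim: s p => [|r s IHs] p /=.
  by move=> _ ->; left; apply: connect0.
move=> /andP[pr rs] /(IHs _ rs)[rq|[t rt tq]]; first by right; exists r.
by left; apply: ev_trans tq; apply/force2_ev/force2I/rt.
Qed.

(** Parity splits a class into at most two [ev]-classes. *)
Lemma cl_ev3 p q r : cl p q -> cl p r -> [\/ ev p q, ev p r | ev q r].
Proof.
move=> /cl_ev[|[q' pq' q'q]]; first by constructor 1.
move=> /cl_ev[|[r' pr' r'r]]; first by constructor 2.
constructor 3; apply: ev_trans r'r; rewrite ev_sym; apply: ev_trans q'q.
by apply/force2_ev/(@force2I _ _ p) => //; rewrite force_sym.
Qed.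

Lemma ev_match p q p' q' : cl p q -> cl p p' -> cl p q' -> ~~ ev p q -> ~~ ev p' q' ->
  ev p p' && ev q q' \/ ev p q' && ev q p'.
Proof.
move=> pq pp' pq' nev nev'.
have qp' : cl q p' by apply: cl_trans pp'; rewrite cl_sym.
have qq' : cl q q' by apply: cl_trans pq'; rewrite cl_sym.
have [evp|evp|/(negP nev')//] := cl_ev3 pp' pq'; have [evq|evq|/(negP nev')//] := cl_ev3 qp' qq';
  rewrite ?evp ?evq /=; [|by left|by right|]; case/negP: nev; apply: ev_trans evp _;
  by rewrite ev_sym.
Qed.

Lemma forced_cl p q : cl p q -> forced p -> forced q.
Proof.
rewrite cl_sym => /connectP[[|r s]] /=; first by move=> _ ->.
by move=> /andP[qr _] _ _; apply/existsP; exists r.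
Qed.

Lemma forced_rev p : forced (rev_pair p) = forced p.
Proof.
by apply/existsP/existsP => -[q pq]; exists (rev_pair q); rewrite -force_rev;
  case: p q pq => [? ?] [? ?].
Qed.

Lemma forcedI p q : force p q -> forced p.
Proof. by move=> pq; apply/existsP; exists q. Qed.

Lemma forced_neq a b : forced (a, b) -> a != b.
Proof.
by move=> /existsP[[c d] /and4P[/= ac bd ad bc]]; apply: contraTneq ac => ->.
Qed.

(** The link is a pair [(x, y)] forced by both: [x] is adjacent to [a] and [c] but not to [b], and
    [y] to [b] only. *)
Lemma chord a b c : forced (a, b) -> forced (b, c) -> ~~ forced (a, c) ->
  cl (a, b) (c, b).
Proof.
move=> /existsP[[p q] /and4P[/= ap bq aq bp]] /existsP[[q' p'] /and4P[/= bq' cp' bp' cq']] nac.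
have key x y : e a x -> e b y -> e c x -> ~~ e a y -> ~~ e b x -> ~~ e c y ->
    cl (a, b) (c, b).
  move=> *; apply: (@cl_trans (x, y)); last rewrite cl_sym;
  by apply: force_cl; apply/and4P.
have [/andP[cp aq']|out] := boolP (e c p && ~~ e a q'); first exact: (key p q').
(* If [p] and [q'] fail, [a] has a neighbour that [c] lacks. As [(a, c)] is not forced, every
   neighbour of [c] is then one of [a], and [p'], [q] serve. *)
have [u au cu] : exists2 u, e a u & ~~ e c u.
  by move: out; rewrite negb_and negbK => /orP[cp|aq']; [exists p|exists q'].
have sub v : e c v -> e a v.
  move=> cv; apply: contraR nac => av.
  by apply/existsP; exists (u, v); apply/and4P.
by apply: (key p' q) => //; [apply: sub|apply: contra aq; apply: sub].
Qed.

Definition compat p q := ~~ cl p (rev_pair q).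

Lemma compat_sym : symmetric compat.
Proof.
move=> p q; rewrite /compat -(cl_rev p) cl_sym.
by case: q.
Qed.

Lemma compat_cl p q p' q' : cl p p' -> cl q q' -> compat p q -> compat p' q'.
Proof.
move=> pp' qq'; apply: contra => p'q'; apply: (cl_trans pp'); apply: (cl_trans p'q').
by rewrite cl_rev cl_sym.
Qed.

(** Stated for three pairs, so that each can be replaced within its class even when two arcs of the
    triangle trade places ([circuit3_swap]). *)
Definition circuit3 p q r :=
  [&& [&& forced p, forced q & forced r] , compat p q, compat q r & compat r p].

Definition circuit a b c := circuit3 (a, b) (b, c) (c, a).

Lemma circuit3_cl p q r p' q' r' : cl p p' -> cl q q' -> cl r r' ->
  circuit3 p q r -> circuit3 p' q' r'.
Proof.
move=> pp' qq' rr' /and4P[/and3P[Fp Fq Fr] pq qr rp].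
by rewrite /circuit3 (forced_cl pp') ?(forced_cl qq') ?(forced_cl rr') //=;
  apply/and3P; split; [apply: compat_cl pq|apply: compat_cl qr|apply: compat_cl rp].
Qed.

Lemma circuit3_swap p q r : circuit3 p q r = circuit3 p r q.
Proof.
rewrite /circuit3 (compat_sym p q) (compat_sym q r) (compat_sym r p).
by case: (forced q) (forced r) (forced p) (compat q p) (compat r q) (compat p r)
  => [] [] [] [] [] [].
Qed.

Lemma circuit3_rot p q r : circuit3 p q r = circuit3 q r p.
Proof.
rewrite /circuit3.
by case: (forced q) (forced r) (forced p) (compat p q) (compat q r) (compat r p)
  => [] [] [] [] [] [].
Qed.

Lemma circuit_rot a b c : circuit a b c = circuit b c a.
Proof. exact: circuit3_rot. Qed.

Lemma circuit_rev a b c : circuit a b c -> circuit c b a.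
Proof.
rewrite /circuit circuit3_rot circuit3_swap => /and4P[/and3P[F1 F2 F3] c1 c2 c3].
have rv p q : compat p q -> compat (rev_pair p) (rev_pair q).
  by rewrite /compat cl_rev.
by apply/and4P; split; rewrite -?(forced_rev (c, b)) -?(forced_rev (b, a))
  -?(forced_rev (a, c)) ?F1 ?F2 ?F3 //; apply: (rv (_, _) (_, _)).
Qed.

(* A vertex adjacent to exactly one end of the forced pair would make two of the
   three classes opposite. *)
Lemma circuit_types a b c x y : circuit a b c -> force (a, b) (x, y) -> e c x = e c y.
Proof.
move=> /and4P[_ abc _ cab] /and4P[/= ax by_ ay bx].
have [cx|cx] := boolP (e c x); have [cy|cy] := boolP (e c y) => //.
  case/negP: abc; apply: (@cl_trans (x, y)); last rewrite cl_sym;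
  by apply: force_cl; apply/and4P.
case/negP: cab; apply: (@cl_trans (y, x)); last rewrite cl_sym;
by apply: force_cl; apply/and4P.
Qed.

(** [z] is one of the two vertices that show [(b, c)] to be forced; the images of the other two arcs
    are exchanged exactly when [c] is adjacent to [x] and [y]. The triangle [x y z] is again a
    circuit, so [circuit_types] applies to it too and a second step can return to [c]. *)
Lemma circuit_force a b c x y : circuit a b c -> force (a, b) (x, y) ->
  exists z,
    (force (b, c) (y, z) && force (c, a) (z, x) || force (b, c) (z, x) && force (c, a) (y, z)) /\
    forall a' b', force (x, y) (a', b') -> force2 (b, c) (b', c) && force2 (c, a) (c, a').
Proof.
move=> abc abxy; have bca : circuit b c a by rewrite -circuit_rot.
have [/= ax by_ ay bx] := and4P abxy.
have cxy := circuit_types abc abxy.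
have /and4P[/and3P[_ /existsP[[u v] /and4P[/= bu cv bv cu]] _] _ _ _] := abc.
have [cx|cx] := boolP (e c x).
  have bcux : force (b, c) (u, x) by apply/and4P.
  have au : e a u by rewrite (circuit_types bca bcux).
  have cay : force (c, a) (y, u) by apply/and4P; split; rewrite //= -cxy.
  exists u; rewrite bcux cay orbT; split=> // a' b' /[dup] xyab /and4P[/= xa yb xb ya].
  have xyu : circuit x y u.
    move: abc; rewrite /circuit circuit3_swap.
    by apply: circuit3_cl; apply: force_cl.
  have xyab' : force (x, y) (a, b') by apply/and4P; split; rewrite //= e_sym.
  have ub' : e u b' by rewrite -(circuit_types xyu xyab') e_sym.
  have ua' : e u a' by rewrite (circuit_types xyu xyab).
  apply/andP; split; [apply: force2I bcux _|apply: force2I cay _];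
  by apply/and4P; split; rewrite //= e_sym // -cxy.
have bcyv : force (b, c) (y, v) by apply/and4P; split; rewrite //= -cxy.
have av : ~~ e a v by rewrite -(circuit_types bca bcyv).
have cavx : force (c, a) (v, x) by apply/and4P.
exists v; rewrite bcyv cavx; split=> // a' b' /[dup] xyab /and4P[/= xa yb xb ya].
have xyv : circuit x y v by move: abc; apply: circuit3_cl; apply: force_cl.
have xyab' : force (x, y) (a, b') by apply/and4P; split; rewrite //= e_sym.
have vb' : ~~ e v b' by rewrite -(circuit_types xyv xyab') e_sym.
have va' : ~~ e v a' by rewrite (circuit_types xyv xyab).
apply/andP; split; [apply: force2I bcyv _|apply: force2I cavx _];
by apply/and4P; split; rewrite //= e_sym // -cxy.
Qed.

Lemma circuit_ev a b c a' b' : circuit a b c -> ev (a, b) (a', b') ->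
  ev (b, c) (b', c) && ev (c, a) (c, a').
Proof.
move=> abc /connectP[s].
elim: s a b abc => [|[a1 b1] s IHs] a b abc /=; first by move=> _ [-> ->]; rewrite /ev !connect0.
case/andP=> /existsP[[x y] /andP[abxy xyab]] path_s Dab.
have [z [_ /(_ _ _ xyab)/andP[bc ca]]] := circuit_force abc abxy.
have abc1 : circuit a1 b1 c.
  move: abc; apply: circuit3_cl; rewrite ev_cl // force2_ev //.
  by apply: force2I abxy xyab.
have /andP[bc' ca'] := IHs _ _ abc1 path_s Dab.
by rewrite (ev_trans (force2_ev bc) bc') (ev_trans (force2_ev ca) ca').
Qed.

Definition oriented (R : {set T * T}) :=
  [/\ forall p q, force p q -> p \in R -> q \in R,
      forall p, p \in R -> forced p &
      forall p, p \in R -> rev_pair p \notin R].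

Lemma oriented_cl R p q : oriented R -> cl p q -> p \in R -> q \in R.
Proof.
move=> [clR _ _] /connectP[s]; elim: s p => [|r s IHs] p /=; first by move=> _ ->.
by move=> /andP[pr rs] Dq pR; apply: IHs rs Dq _; apply: clR pr pR.
Qed.

Lemma oriented_ev R p q : oriented R -> ev p q -> p \in R -> q \in R.
Proof. by move=> oR /ev_cl; apply: oriented_cl. Qed.

(** By [chord], an unforced [(x, z)] would put [(z, y)], the reverse of [(y, z)], into [R]. *)
Lemma oriented_circuit R x y z : oriented R -> (x, y) \in R -> (y, z) \in R ->
  (x, z) \notin R -> circuit x y z.
Proof.
move=> oR xy yz xz; have [_ FR aR] := oR.
have xyzy : ~~ cl (x, y) (z, y).
  by apply: contra (aR _ yz) => /(oriented_cl oR); apply.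
have Fxz : forced (x, z).
  by apply: contraR xyzy; apply: chord; apply: FR.
apply/and4P; split=> //.
- by rewrite (FR _ xy) (FR _ yz) -forced_rev.
- by apply: contra xz => /(oriented_cl oR); apply.
- by apply: contra xz; rewrite cl_sym -cl_rev => /(oriented_cl oR); apply.
Qed.

(** By [circuit_ev], an even connection would lead on from [(b, c)] to [(c, c)], which is never
    forced. *)
Lemma oriented_ev_step R a b c : oriented R -> circuit a b c ->
  (a, b) \in R -> (b, c) \in R -> ~~ ev (a, b) (b, c).
Proof.
move=> oR abc ab bc; have [_ FR _] := oR.
apply/negP => /(circuit_ev abc)/andP[/(oriented_ev oR) /(_ bc) /FR /forced_neq].
by rewrite eqxx.
Qed.

End Forcing.

(** * Cycles created by adding an undecided class *)

Section Conflicts.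
Variables (T : finType) (e : rel T).
Hypothesis e_sym : symmetric e.

Definition conflict1 (D A : {set T * T}) := exists a b c,
  [/\ (a, b) \in A, (b, c) \in A & (c, a) \in D].

Definition conflict2 (D A : {set T * T}) := exists a b a' b',
  [/\ (a, b) \in A, (b, a') \in D, (a', b') \in A, (b', a) \in D &
      circuit e a b a' /\ circuit e a' b' a].

Definition undecided (D A : {set T * T}) :=
  [/\ oriented e A, {in A &, forall p q, cl e p q},
      forall p, p \in A -> p \notin D &
      forall p, p \in A -> rev_pair p \notin D].

Lemma undecided_oriented D A : oriented e D -> undecided D A -> oriented e (D :|: A).
Proof.
move=> [clD FD aD] [[clA FA aA] _ AD ArD]; split=> [p q pq|p|p].
- by rewrite !inE => /orP[/(clD _ _ pq)|/(clA _ _ pq)] ->; rewrite ?orbT.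
- by rewrite inE => /orP[/FD|/FA].
rewrite !inE negb_or => /orP[pD|pA]; last by rewrite ArD ?aA.
rewrite aD //=; apply/negP => /ArD; case: p pD => x y pD.
by rewrite pD.
Qed.

(** By [cycle_shortcut] it is enough to refute an infinite walk without shortcuts. Its consecutive
    arcs span circuits, and [A] has at most two [ev]-classes, so [circuit_ev] excludes certain words
    in the labels [A] and [D]; every word of six letters contains one of them. *)
Lemma conflict_free_acyclic D A : oriented e D -> undecided D A -> transitive (arc_of D) ->
  ~ conflict1 D A -> ~ conflict2 D A -> acyclic (D :|: A).
Proof.
move=> oD uA trD no1 no2; apply/acyclicP => x0 y0 x0y0; apply/negP => /connectP[s ys Dx0].
have oR := undecided_oriented oD uA; have [oA clA AD ArD] := uA.
have [_ _ aR] := oR; pose R := arc_of (D :|: A).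
have RR x y : R x y -> ~~ R y x by move/aR.
have irrR : irreflexive R by move=> x; apply/negP => Rxx; case/negP: (RR _ _ Rxx).
have DR x y : arc_of D x y -> R x y by rewrite /R /arc_of inE => ->.
have AR x y : arc_of A x y -> R x y by rewrite /R /arc_of inE orbC => ->.
have R_ev x y x' y' : R x y -> ev e (x, y) (x', y') -> R x' y'.
  by move=> xy /(oriented_ev oR); apply.
have D_ev x y x' y' : arc_of D x y -> ev e (x, y) (x', y') -> arc_of D x' y'.
  by move=> xy /(oriented_ev oD); apply.
have stepC x y z : R x y -> R y z -> ~~ R x z -> circuit e x y z.
  exact: (oriented_circuit e_sym oR).
have A_ev3 x y z x' y' z' : arc_of A x x' -> arc_of A y y' -> arc_of A z z' ->
    [\/ ev e (x, x') (y, y'), ev e (x, x') (z, z') | ev e (y, y') (z, z')].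
  by move=> xx' yy' zz'; apply: (cl_ev3 e_sym); apply: clA.
have noev x y z : R x y -> R y z -> ~~ R x z -> ~ ev e (x, y) (y, z).
  by move=> xy yz /(stepC _ _ _ xy yz) xyz; apply/negP/(oriented_ev_step e_sym oR xyz).
(* The forbidden factors of an irreducible walk, arcs being labelled by D or A. *)
have noDD x y z : arc_of D x y -> arc_of D y z -> ~~ R x z -> False.
  by move=> xy /(trD _ _ _ xy)/DR ->.
have noAAA x y z w : arc_of A x y -> arc_of A y z -> arc_of A z w -> ~~ R x z -> ~~ R y w -> False.
  (* Two of the three arcs share an [ev]-class, and by [noev] they are not consecutive. For the
     outer two, [circuit_ev] takes [(y, z)] to [(w, z)], the reverse of an arc of the walk. The
     longer factors below are treated alike, some cases ending in a conflict. *)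
  move=> xy yz zw xz yw; have xyz := stepC _ _ _ (AR _ _ xy) (AR _ _ yz) xz.
  case: (A_ev3 _ _ _ _ _ _ xy yz zw); try by apply: noev; rewrite // AR.
  case/(circuit_ev e_sym xyz)/andP => /(R_ev _ _ _ _ (AR _ _ yz))/RR.
  by rewrite AR.
have noAADA x y z w v : arc_of A x y -> arc_of A y z -> arc_of D z w -> arc_of A w v ->
   ~~ R x z -> ~~ R y w -> ~~ R z v -> False.
  move=> xy yz zw wv xz yw zv.
  have xyz := stepC _ _ _ (AR _ _ xy) (AR _ _ yz) xz.
  have yzw := stepC _ _ _ (AR _ _ yz) (DR _ _ zw) yw.
  case: (A_ev3 _ _ _ _ _ _ xy yz wv); first by apply: noev; rewrite // AR.
    case/(circuit_ev e_sym xyz)/andP => _; rewrite ev_sym // => /(D_ev _ _ _ _ zw) zx.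
    by case: no1; exists x, y, z.
  case/(circuit_ev e_sym yzw)/andP => /(R_ev _ _ _ _ (DR _ _ zw))/RR.
  by rewrite AR.
have noADAA x y z w v : arc_of A x y -> arc_of D y z -> arc_of A z w -> arc_of A w v ->
   ~~ R x z -> ~~ R y w -> ~~ R z v -> False.
  move=> xy yz zw wv xz yw zv.
  have xyz := stepC _ _ _ (AR _ _ xy) (DR _ _ yz) xz.
  have zwv := stepC _ _ _ (AR _ _ zw) (AR _ _ wv) zv.
  case: (A_ev3 _ _ _ _ _ _ xy zw wv); last by apply: noev; rewrite // AR.
    case/(circuit_ev e_sym xyz)/andP => /(R_ev _ _ _ _ (DR _ _ yz))/RR.
    by rewrite AR.
  move: zwv; rewrite ev_sym // circuit_rot => zwv /(circuit_ev e_sym zwv)/andP[vz _].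
  have {}vz : arc_of D v z by apply: D_ev yz _; rewrite ev_sym.
  by case: no1; exists z, w, v.
have noADADA x y z w v u : arc_of A x y -> arc_of D y z -> arc_of A z w -> arc_of D w v -> arc_of A v u ->
   ~~ R x z -> ~~ R y w -> ~~ R z v -> ~~ R w u -> False.
  move=> xy yz zw wv vu xz yw zv wu.
  have xyz := stepC _ _ _ (AR _ _ xy) (DR _ _ yz) xz.
  have zwv := stepC _ _ _ (AR _ _ zw) (DR _ _ wv) zv.
  case: (A_ev3 _ _ _ _ _ _ xy zw vu).
  - case/(circuit_ev e_sym xyz)/andP => /(R_ev _ _ _ _ (DR _ _ yz))/RR.
    by rewrite AR.
  - have := stepC _ _ _ (DR _ _ wv) (AR _ _ vu) wu; rewrite circuit_rot => vuw.
    rewrite ev_sym // => /(circuit_ev e_sym vuw)/andP[_] /(D_ev _ _ _ _ wv) wx.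
    (* The arc [(w, x)] of [D] closes the cycle [x y z w]; a chord [(z, x)] would contradict
       antisymmetry or [no1]. *)
    case: no2; exists x, y, z, w; split; rewrite -?[_ \in _]/(arc_of _ _ _) //.
    split=> //; apply: stepC; [exact: AR|exact: DR|].
    rewrite /R /arc_of inE negb_or; apply/andP; split; apply/negP => zx; last first.
      by case: no1; exists z, x, y.
    by have := RR _ _ (AR _ _ xy); rewrite DR ?(trD _ _ _ yz zx).
  case/(circuit_ev e_sym zwv)/andP => /(R_ev _ _ _ _ (DR _ _ wv))/RR.
  by rewrite AR.
apply: (@cycle_shortcut _ R (y0 :: s)) => //; first by rewrite /= rcons_path ys -Dx0.
move=> f Rf; pose nf i := ~~ R (f i) (f i.+2).
have RDA i : {arc_of D (f i) (f i.+1)} + {arc_of A (f i) (f i.+1)}.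
  by have := Rf i; rewrite /R /arc_of inE; case: (_ \in D); [left|right].
(* Five turns without shortcut involve six arcs, enough for a forbidden factor. *)
have : ~~ [&& nf 0, nf 1, nf 2, nf 3 & nf 4].
  apply/negP => /and5P[n0 n1 n2 n3 n4].
  case: (RDA 0) => h0; case: (RDA 1) => h1; try exact: (noDD _ _ _ h0 h1);
  case: (RDA 2) => h2; try exact: (noDD _ _ _ h1 h2); try exact: (noAAA _ _ _ _ h0 h1 h2);
  case: (RDA 3) => h3; try exact: (noDD _ _ _ h2 h3); try exact: (noAAA _ _ _ _ h1 h2 h3);
    try exact: (noAADA _ _ _ _ _ h0 h1 h2 h3); try exact: (noADAA _ _ _ _ _ h0 h1 h2 h3);
  case: (RDA 4) => h4; try exact: (noDD _ _ _ h3 h4); try exact: (noAAA _ _ _ _ h2 h3 h4);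
    try exact: (noAADA _ _ _ _ _ h1 h2 h3 h4); try exact: (noADAA _ _ _ _ _ h1 h2 h3 h4);
    try exact: (noADADA _ _ _ _ _ _ h0 h1 h2 h3 h4);
  case: (RDA 5) => h5; try exact: (noDD _ _ _ h4 h5); try exact: (noADAA _ _ _ _ _ h2 h3 h4 h5);
    exact: (noADADA _ _ _ _ _ _ h1 h2 h3 h4 h5).
by rewrite /nf !negb_and !negbK => /or4P[?|?|?|/orP[?|?]]; eexists; eassumption.
Qed.

Definition rev_set (A : {set T * T}) := [set p | rev_pair p \in A].

Lemma undecided_rev D A : undecided D A -> undecided D (rev_set A).
Proof.
move=> [[clA FA aA] clAA AD ArD]; split=> [|p q|p|p]; rewrite ?inE //.
- split=> [p q pq|p|p]; rewrite !inE.
  + by apply: clA; rewrite force_rev.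
  + by move/FA; rewrite forced_rev.
  by move/aA.
- by rewrite -cl_rev; apply: clAA.
- by move/ArD; case: p.
exact: AD.
Qed.

Lemma conflict1_circuit D A a b c : oriented e D -> undecided D A ->
  (a, b) \in A -> (b, c) \in A -> (c, a) \in D -> circuit e a b c /\ ~~ ev e (a, b) (b, c).
Proof.
move=> oD uA ab bc ca; have oR := undecided_oriented oD uA; have [_ _ aR] := oR.
have abc : circuit e a b c.
  by apply: (oriented_circuit e_sym oR); rewrite ?inE ?ab ?bc ?orbT // -in_setU (aR (c, a)) // inE ca.
split=> //; apply: (oriented_ev_step e_sym oR abc); by rewrite inE ?ab ?bc orbT.
Qed.

(** Otherwise [circuit_ev] takes [(b, a')] to [(b', a')] within [D], although [(a', b')] is
    undecided. *)
Lemma conflict2_ev D A a b a' b' : oriented e D -> undecided D A ->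
  (b, a') \in D -> (a', b') \in A -> circuit e a b a' -> ~~ ev e (a, b) (a', b').
Proof.
move=> oD [_ _ _ ArD] ba' a'b' aba'; apply: contra (ArD _ a'b').
by case/(circuit_ev e_sym aba')/andP => /(oriented_ev oD) /(_ ba').
Qed.

(** In each conflict the two arcs of the class represent both of its [ev]-classes, so [ev_match]
    aligns the conflicts. One alignment puts [(z, x)] next to [(x, z)] in [D], the other puts both
    [(y, b)] and [(b, y)] in [A]. *)
Lemma conflict11 D A : oriented e D -> undecided D A ->
  conflict1 D A -> conflict1 D (rev_set A) -> False.
Proof.
move=> oD uA [a [b [c [ab bc ca]]]] [z [y [x [yz xy xz]]]].
have [abc nabc] := conflict1_circuit oD uA ab bc ca.
have [/(circuit_rev e_sym) xyz nxyz] := conflict1_circuit oD (undecided_rev uA) yz xy xz.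
move: yz xy nxyz; rewrite !inE /= /rev_pair /= -ev_rev /= ev_sym // => yz xy nxyz.
have [_ clA _ _] := uA; have [_ _ aD] := oD; have [[_ _ aA] _ _ _] := uA.
have bca : circuit e b c a by rewrite -circuit_rot.
have cab : circuit e c a b by rewrite circuit_rot.
have yzx : circuit e y z x by rewrite -circuit_rot.
have := ev_match e_sym (clA _ _ ab bc) (clA _ _ ab xy) (clA _ _ ab yz) nabc nxyz.
case=> /andP[].
  move=> /(circuit_ev e_sym abc)/andP[bcyc cacx] bcyz.
  have yzyc : ev e (y, z) (y, c) by apply: ev_trans bcyc; rewrite ev_sym.
  have /andP[zxcx _] := circuit_ev e_sym yzx yzyc.
  have xc : (c, x) \in D by apply: oriented_ev cacx ca.
  by have := aD _ xz; rewrite /rev_pair /= (oriented_ev oD _ xc) // ev_sym.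
move=> /(circuit_ev e_sym abc)/andP[_ cacy] /(circuit_ev e_sym bca)/andP[caya _].
have /andP[abyb _] := circuit_ev e_sym cab cacy.
have /andP[_ bcby] := circuit_ev e_sym cab caya.
have [oA _ _ _] := uA.
by have := aA _ (oriented_ev oA abyb ab); rewrite (oriented_ev oA bcby).
Qed.

Lemma conflict12 D A : oriented e D -> undecided D A ->
  conflict1 D A -> conflict2 D (rev_set A) -> False.
Proof.
move=> oD uA [a [b [c [ab bc ca]]]] [p [q [p' [q' [pq qp' pq' q'p [pqp' pqp]]]]]].
have [abc nabc] := conflict1_circuit oD uA ab bc ca.
have := conflict2_ev oD (undecided_rev uA) qp' pq' pqp'.
move: pq pq'; rewrite !inE /= /rev_pair /= -ev_rev /rev_pair /= => pq pq' npq.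
have [_ clA _ _] := uA; have [_ _ aD] := oD.
have bca : circuit e b c a by rewrite -circuit_rot.
(* Both alignments have this shape; each would put [(r', a)] and [(a, r')] in [D]. *)
have key r s r' s' : ev e (a, b) (s, r) -> ev e (b, c) (s', r') ->
    circuit e r s r' -> (s, r') \in D -> False.
  move=> absr bcsr rsr' sr'.
  have /andP[car'a _] := circuit_ev e_sym bca bcsr.
  have srr' : circuit e s r r' by have:= circuit_rev e_sym rsr'; rewrite circuit_rot.
  rewrite ev_sym // in absr.
  have /andP[_ ] := circuit_ev e_sym srr' absr.
  rewrite -ev_rev /rev_pair /= => /(oriented_ev oD) /(_ sr')/aD.
  by rewrite /rev_pair /= (oriented_ev oD car'a).
have := ev_match e_sym (clA _ _ ab bc) (clA _ _ ab pq) (clA _ _ ab pq') nabc npq.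
by case=> /andP[absr bcsr]; apply: (key _ _ _ _ absr bcsr).
Qed.

Lemma conflict22 D A : oriented e D -> undecided D A ->
  conflict2 D A -> conflict2 D (rev_set A) -> False.
Proof.
move=> oD uA [a [b [a' [b' [ab ba' ab' b'a [aba' aba]]]]]].
move=> [p [q [p' [q' [pq qp' pq' q'p [pqp' pqp]]]]]].
have nab := conflict2_ev oD uA ba' ab' aba'.
have := conflict2_ev oD (undecided_rev uA) qp' pq' pqp'.
move: pq pq'; rewrite !inE /= /rev_pair /= -ev_rev /rev_pair /= => pq pq' npq.
have [_ clA _ _] := uA; have [_ _ aD] := oD.
(* As in [conflict12], with [(b', a)] in the role of [(c, a)]. *)
have key r s r' s' : ev e (a, b) (s, r) -> ev e (a', b') (s', r') ->
    circuit e r s r' -> (s, r') \in D -> False.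
  move=> absr absr' rsr' sr'.
  have srr' : circuit e s r r' by have:= circuit_rev e_sym rsr'; rewrite circuit_rot.
  have /andP[bar'a _] := circuit_ev e_sym aba absr'.
  rewrite ev_sym // in absr.
  have /andP[_ ] := circuit_ev e_sym srr' absr.
  rewrite -ev_rev /rev_pair /= => /(oriented_ev oD) /(_ sr')/aD.
  by rewrite /rev_pair /= (oriented_ev oD bar'a).
have := ev_match e_sym (clA _ _ ab ab') (clA _ _ ab pq) (clA _ _ ab pq') nab npq.
by case=> /andP[absr absr']; apply: (key _ _ _ _ absr absr').
Qed.

End Conflicts.

(** * Maximal acyclic orientations *)

Section Orientation.
Variables (T : finType) (e : rel T).
Hypothesis e_sym : symmetric e.

(** Boolean, so that [maxset] applies; acyclicity already excludes opposite pairs. *)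
Definition acyclic_orientation (D : {set T * T}) :=
  [forall p in D, forced e p && [forall q, force e p q ==> (q \in D)]] && acyclic D.

Lemma acyclic_orientationP D : reflect (oriented e D /\ acyclic D) (acyclic_orientation D).
Proof.
apply: (iffP andP) => -[]; last first.
  move=> [clD FD _] acD; split=> //; apply/forall_inP => p pD.
  by rewrite FD //; apply/forallP => q; apply/implyP => pq; apply: clD pD.
move=> /forall_inP oD acD; split=> //; split=> [p q pq /oD|p /oD|[x y] xy].
- by case/andP => _ /forallP/(_ q)/implyP; apply.
- by case/andP.
by have /acyclicP/(_ _ _ xy) := acD; apply: contra => yx; apply: (@connect1 _ (arc_of D)).
Qed.

Section Maximal.
Variable D : {set T * T}.
Hypothesis maxD : maxset acyclic_orientation D.

Let oD : oriented e D.
Proof. by have /maxsetP[/acyclic_orientationP[]] := maxD. Qed.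

Let acD : acyclic D.
Proof. by have /maxsetP[/acyclic_orientationP[]] := maxD. Qed.

Let maximal (A : {set T * T}) : (forall p q, force e p q -> p \in A -> q \in A) ->
  (forall p, p \in A -> forced e p) -> acyclic (D :|: A) -> A \subset D.
Proof.
move=> clA FA acDA; have /maxsetP[_ /(_ (D :|: A)) DA] := maxD.
rewrite -DA ?subsetUr ?subsetUl //; apply/andP; split=> //.
have [clD FD _] := oD.
apply/forall_inP => p; rewrite inE => pDA.
apply/andP; split; first by case/orP: pDA => [/FD|/FA].
apply/forallP => q; apply/implyP => pq; rewrite inE.
by case/orP: pDA => [/(clD _ _ pq)|/(clA _ _ pq)] ->; rewrite ?orbT.
Qed.

(** Every pair in the class of a missing [(x, z)] is bridged by two arcs of [D], so adding this
    class creates no cycle, against maximality. *)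
Lemma maximal_trans : transitive (arc_of D).
Proof.
move=> y x z xy yz; apply/negPn/negP => xz.
have [clD FD aD] := oD.
have Fxz : forced e (x, z).
  by case/and4P: (oriented_circuit e_sym oD xy yz xz) => /and3P[_ _]; rewrite -forced_rev.
have path2 q : cl e (x, z) q -> exists2 w, (q.1, w) \in D & (w, q.2) \in D.
  have : exists2 w, ((x, z).1, w) \in D & (w, (x, z).2) \in D by exists y.
  have : (x, z) \notin D by [].
  move=> + + /connectP[s]; elim: s (x, z) => [|[u' v'] s IHs] [u v] /=; first by move=> _ ? _ ->.
  move=> uv [w uw wv] /andP[uv' path_s] Dq; apply: IHs path_s Dq.
    by apply: contra uv; apply: clD; rewrite force_sym.
  have vuw : circuit e v u w by rewrite circuit_rot; apply: (oriented_circuit e_sym oD).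
  have vu' : force e (v, u) (v', u') by rewrite -force_rev.
  (* [t] replaces [w] as the midpoint; in one alternative the two halves of the path trade
     places. *)
  have [t [/orP[]/andP[f1 f2] _]] := circuit_force e_sym vuw vu'; exists t.
  - exact: clD f1 uw.
  - exact: clD f2 wv.
  - exact: clD f2 wv.
  exact: clD f1 uw.
case/negP: (xz); apply: (subsetP (@maximal [set q | cl e (x, z) q] _ _ _)).
- by move=> p q pq; rewrite !inE => /connect_trans; apply; apply: force_cl.
- by move=> p; rewrite inE => /forced_cl; apply.
- have sub u v : connect (arc_of (D :|: [set q | cl e (x, z) q])) u v -> connect (arc_of D) u v.
    apply: connect_sub => {}u {}v; rewrite /arc_of !inE => /orP[uv|/path2[w uw wv]].
      exact: connect1.
    exact: connect_trans (connect1 uw) (connect1 wv).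
  apply/acyclicP => u v; rewrite !inE => /orP[uv|/path2[/= w uw wv]].
    by have /acyclicP/(_ _ _ uv) := acD; apply/contra/sub.
  have /acyclicP/(_ _ _ uw) := acD; apply/contra => /sub; apply: connect_trans.
  exact: connect1.
by rewrite inE cl_refl.
Qed.

(** For an undecided [p], maximality gives a conflict of [D] with the class of [p] and another with
    the opposite class; no two such conflicts coexist. *)
Lemma maximal_total p : (forall a b, a != b -> ~~ cl e (a, b) (b, a)) ->
  forced e p -> (p \in D) || (rev_pair p \in D).
Proof.
move=> NI Fp; apply/negPn; rewrite negb_or; apply/negP => /andP[pD rpD].
have [clD FD aD] := oD.
pose A := [set q | cl e p q].
have Acl q r : force e q r -> q \in A -> r \in A.
  by move=> qr; rewrite !inE => /connect_trans; apply; apply: force_cl.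
have AF q : q \in A -> forced e q by rewrite inE => /forced_cl; apply.
have uA : undecided e D A.
  split.
  - split=> // -[a b] abA; apply: contra (NI _ _ (forced_neq (AF _ abA))) => baA.
    by move: abA baA; rewrite !inE cl_sym //; apply: cl_trans.
  - by move=> q r; rewrite !inE => pq; apply: cl_trans; rewrite cl_sym.
  - move=> q; rewrite inE cl_sym // => qp; apply: contra pD; exact: oriented_cl oD qp.
  move=> q; rewrite inE cl_sym // => qp; apply: contra rpD.
  by apply: (oriented_cl oD); rewrite cl_rev.
have nac B q : undecided e D B -> q \in B -> q \notin D -> ~~ acyclic (D :|: B).
  move=> [[clB FB _] _ _ _] qB; apply: contra => acB.
  by apply: (subsetP (maximal clB FB acB)).
have uA' := undecided_rev uA.
have pA : p \in A by rewrite inE cl_refl.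
have pA' : rev_pair p \in rev_set A by rewrite inE /rev_pair -surjective_pairing.
case/negP: (nac _ _ uA pA pD).
apply: (conflict_free_acyclic e_sym oD uA maximal_trans) => cA;
case/negP: (nac _ _ uA' pA' rpD);
apply: (conflict_free_acyclic e_sym oD uA' maximal_trans) => cA'.
- exact: conflict11 oD uA cA cA'.
- exact: conflict12 oD uA cA cA'.
- apply: (conflict12 e_sym oD uA' cA').
  have -> //: rev_set (rev_set A) = A by apply/setP => -[a b]; rewrite !inE.
exact: conflict22 oD uA cA cA'.
Qed.

End Maximal.

Lemma orientation_exists : (forall a b, a != b -> ~~ cl e (a, b) (b, a)) ->
  exists D : {set T * T}, [/\ oriented e D, transitive (arc_of D) &
    forall p, forced e p -> (p \in D) || (rev_pair p \in D)].
Proof.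
move=> NI; have [|D maxD] := @ex_maxset _ acyclic_orientation.
  exists set0; apply/andP; split; first by apply/forall_inP => p; rewrite inE.
  by apply/acyclicP => x y; rewrite inE.
exists D; split; [|exact: maximal_trans|by move=> p; apply: maximal_total].
by have /maxsetP[/acyclic_orientationP[]] := maxD.
Qed.

(** In a linear extension of [D], a Slash in rows [i < j] and columns [k < l] would make
    [(s i, s j)] force [(s l, s k)], an arc of [D] in the wrong order. *)
Lemma no_invertible_pair_order : (forall a b, a != b -> ~~ cl e (a, b) (b, a)) ->
  strong_cocomparability e.
Proof.
move=> /orientation_exists[D [oD trD totD]].
have [_ _ aD] := oD; have [clD _ _] := oD.
have irrD : irreflexive (arc_of D).
  by move=> x; apply/negP => xx; case/negP: (aD _ xx).
have [r r_inj rD] := linear_extension trD irrD.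
have [s rK sK] : bijective r by apply: inj_card_bij; rewrite ?card_ord.
exists s; split; first by exists r.
move=> [i [j [k [l [ij kl]]]]]; rewrite !mxE => ik il [jk jl].
have ijlk : force e (s i, s j) (s l, s k).
  by apply/and4P; split; rewrite /= ?il ?jk ?ik ?jl.
have DR x y : (s x, s y) \in D -> x < y by move/rD; rewrite !sK.
have /totD/orP[ijD|/DR] := forcedI ijlk; last by rewrite ltnNge ltnW.
by have /DR := clD _ _ ijlk ijD; rewrite ltnNge ltnW.
Qed.

End Orientation.

(** * Avoidance of edges, and asteroids from invertible pairs *)

Section Asteroids.
Variables (T : finType) (e : rel T).
Hypotheses (e_refl : reflexive e) (e_sym : symmetric e).

(** Thanks to the loops, a shared end falsifies both alternatives on the right, and they merge when
    one of the edges is a loop. *)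
Lemma avoidsE u u' v v' : e u u' -> e v v' -> avoids e u u' v v' =
  ~~ e u v' && ~~ e u' v || ~~ e u v && ~~ e u' v'.
Proof.
move=> uu' vv'; rewrite /avoids /induces_2K2_P4_C4 uu' vv'.
case: (eqVneq u v) vv' => [<-|uv] vv'; first by rewrite e_refl vv'.
case: (eqVneq u v') vv' => [<-|uv'] vv'; first by rewrite e_refl (e_sym u v) vv' andbF.
case: (eqVneq u' v) vv' => [<-|u'v] vv'; first by rewrite e_refl uu' !andbF.
case: (eqVneq u' v') vv' => [<-|u'v'] vv'; first by rewrite e_refl uu' !andbF.
have [<-|_] := eqVneq u u'; have [<-|_] := eqVneq v v'; rewrite ?andbb ?orbb //=.
- by rewrite andbC orbb.
- by case: (e u v) (e u v') (e u' v) (e u' v') => [] [] [] [].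
Qed.

Lemma invertible_pair_asteroid a b : a != b -> cl e (a, b) (b, a) -> has_weak_edge_asteroid e.
Proof.
move=> ab /connectP[s path_s Ds]; pose n := size s.
have n_gt0 : 0 < n.
  by rewrite /n; case: s Ds {path_s n} => //= -[Dab _]; rewrite Dab eqxx in ab.
pose P i := nth (a, b) ((a, b) :: s) i.
have Pn : P n = rev_pair (P 0) by rewrite /P nth_last /= -Ds.
have PS i : i < n -> force e (P i) (P i.+1) by move/(pathP (a, b))/(_ i): path_s.
(* The walk from [(a, b)] to [(b, a)] continues with its reversal, and so on; shifting by [n]
   reverses the pair. *)
pose p i := iter (i %/ n) (@rev_pair T) (P (i %% n)).
have iter_rev k q q' : force e (iter k (@rev_pair T) q) (iter k (@rev_pair T) q') = force e q q'.
  by elim: k => //= k <-; rewrite force_rev.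
have pS i : force e (p i) (p i.+1).
  have [lt_in|] := ltnP (i %% n).+1 n.
    rewrite /p {3 4}(divn_eq i n) -addnS divnMDl // modnMDl (divn_small lt_in) (modn_small lt_in).
    by rewrite addn0 iter_rev PS // ltn_pmod.
  move=> le_ni; have Din : (i %% n).+1 = n by apply/eqP; rewrite eqn_leq le_ni ltn_pmod.
  rewrite /p {3 4}(divn_eq i n) -addnS Din -mulSnr mulnK // modnMl iterSr -Pn iter_rev.
  by rewrite -{2}Din PS // ltn_pmod.
have pD i : p (i + n) = rev_pair (p i) by rewrite /p divnDr // divnn n_gt0 addn1 modnDr.
pose w i := (p i).1.
have wD i : w (i + n) = (p i).2 by rewrite /w pD.
have wDD i : w (i + n + n) = w i by rewrite /w !pD.
have w1 i : e (w i) (w i.+1) by have /and4P[] := pS i.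
have wN i : ~~ e (w i) (w (i.+1 + n)) by rewrite wD; have /and4P[] := pS i.
have wN' i : ~~ e (w (i + n)) (w i.+1) by rewrite wD; have /and4P[] := pS i.
have av0 i : avoids e (w i) (w i.+1) (w (i + n)) (w (i + n).+1).
  by rewrite avoidsE // -addSn wN e_sym wN'.
have av1 i : avoids e (w i) (w i.+1) (w (i + n).+1) (w (i + n).+2).
  by rewrite avoidsE // -!addSn !wN orbT.
have avC i j : avoids e (w i) (w i.+1) (w j) (w j.+1) -> avoids e (w j) (w j.+1) (w i) (w i.+1).
  by rewrite !avoidsE // ![e (w j) _]e_sym ![e (w j.+1) _]e_sym (andbC (~~ e (w i.+1) _)).
have av2 i : avoids e (w (i + n)) (w (i + n).+1) (w i) (w i.+1) by apply: avC.
have av3 i : avoids e (w (i + n).+1) (w (i + n).+2) (w i) (w i.+1) by apply: avC.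
(* Since [w] has period [2n], edge [2n] repeats edge [0]. Edge [i] thus faces two consecutive edges
   of the closed walk, except that for [i = n] these two coincide and the walk has a single edge. *)
exists n, w, (fun i => w i.+1); split=> //; split=> [i _ //|i lt_i].
have [lt_in|le_ni] := ltnP i n.
  rewrite addn1 !modn_small; [|lia..].
  exists (w (i + n)), [:: w (i + n).+1; w (i + n).+2].
  by rewrite /is_walk /same_edge /avoids_walk /= !eqxx !w1 av0 av1.
have [Di|ne_in] := eqVneq i n.
  rewrite Di addn1 addnn modn_small // modnn.
  exists (w n.*2), [:: w n.*2.+1].
  rewrite /is_walk /same_edge /avoids_walk /= !eqxx !w1 -addnn av0.
  by rewrite -[n + n]add0n addnA wDD -addSn -addSn wDD eqxx.
have [j Di] : exists j, i = (j + n).+1 by exists (i - n.+1); lia.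
have -> : ((i + n) %% n.*2.+1) = j.
  rewrite Di (_ : _ + n = j + n.*2.+1); last lia.
  by rewrite modnDr modn_small //; lia.
have -> : ((i + n + 1) %% n.*2.+1) = j.+1.
  rewrite Di (_ : _ + 1 = j.+1 + n.*2.+1); last lia.
  by rewrite modnDr modn_small //; lia.
exists (w j), [:: w j.+1; w j.+2].
by rewrite /is_walk /same_edge /avoids_walk /= !eqxx !w1 Di av3 -addSn av2.
Qed.

(** * A Slash-free ordering excludes asteroids *)

Section Order.
Variable r : T -> nat.
Hypotheses (r_inj : injective r)
  (r_force : forall a b x y, force e (a, b) (x, y) -> r a < r b -> r x < r y).

Let m u v := minn (r u) (r v).

Let r_forceE a b x y : e a x -> e b y -> ~~ e a y -> ~~ e b x -> (r a < r b) = (r x < r y).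
Proof.
move=> ax by_ ay bx; have abxy : force e (a, b) (x, y) by apply/and4P.
by apply/idP/idP; apply: r_force => //; rewrite force_sym.
Qed.

Lemma avoids_neq_min u u' v v' : avoids e u u' v v' -> m u u' != m v v'.
Proof.
by case/and5P; rewrite -!(inj_eq r_inj) /m; lia.
Qed.

(** Avoidance matches the ends of the two edges so that matched ends compare alike, hence so do the
    minima. If [b] changes its partner between the two edges, it is adjacent to neither [u] nor
    [u'], and the loop at [b] gives the link [Eb]. *)
Lemma avoids_side u u' a b c : e u u' -> e a b -> e b c ->
  avoids e u u' a b -> avoids e u u' b c -> (m u u' < m a b) = (m u u' < m b c).
Proof.
move=> uu' ab bc; have ba : e b a by rewrite e_sym.
move=> av1 av2; have [ua ub u'a u'b _] := and5P av1; have [_ uc _ u'c _] := and5P av2.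
move: ua ub u'a u'b uc u'c; rewrite -!(inj_eq r_inj) => ua ub u'a u'b uc u'c.
move: av1 av2; rewrite !avoidsE // => /orP[]/andP[h1 h2] /orP[]/andP[h3 h4].
- have Eb := r_forceE uu' (e_refl b) h1; rewrite e_sym in h4; have {}Eb := Eb h4.
  rewrite e_sym in h2; have E1 := r_forceE uu' ab h1 h2.
  have E2 := r_forceE uu' bc h3 h4.
  by rewrite /m; lia.
- rewrite e_sym in h2; have E1 := r_forceE uu' ab h1 h2.
  rewrite e_sym in h4; have E2 := r_forceE uu' (etrans (e_sym c b) bc) h3 h4.
  by rewrite /m; lia.
- rewrite e_sym in h2; have E1 := r_forceE uu' ba h1 h2.
  rewrite e_sym in h4; have E2 := r_forceE uu' bc h3 h4.
  by rewrite /m; lia.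
rewrite e_sym in h2; have E1 := r_forceE uu' ba h1 h2.
rewrite e_sym in h4; have E2 := r_forceE uu' (etrans (e_sym c b) bc) h3 h4.
have Eb := r_forceE uu' (e_refl b) h3 h2.
by rewrite /m; lia.
Qed.

Lemma avoids_walk_side u u' w0 ws : e u u' -> path e w0 ws -> avoids_walk e u u' w0 ws ->
  {in walk_edges w0 ws &, forall p q, (m u u' < m p.1 p.2) = (m u u' < m q.1 q.2)}.
Proof.
move=> uu'; have to_head w1 s w : e w w1 -> path e w1 s -> avoids_walk e u u' w (w1 :: s) ->
    forall p, p \in walk_edges w (w1 :: s) -> (m u u' < m p.1 p.2) = (m u u' < m w w1).
  elim: s w w1 => [|w2 s IHs] w w1 ww1 /=; first by move=> _ _ p; rewrite inE => /eqP->.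
  move=> /andP[w12 path_s] /andP[av0 /[dup] /andP[av1 _] av] p.
  rewrite inE => /predU1P[-> //|ps]; rewrite (IHs _ _ w12 path_s av _ ps).
  by rewrite (avoids_side uu' ww1 w12 av0 av1).
by case: ws => [|w1 ws] //= /andP[w01 path_ws] av p q /to_head-> // /to_head->.
Qed.

Lemma order_no_asteroid : ~ has_weak_edge_asteroid e.
Proof.
move=> [k [x [y [k_gt0 [xy ast]]]]]; pose N := k.*2.+1.
pose M i := m (x (i %% N)) (y (i %% N)).
have side i : [/\ (M i < M (i + k)) = (M i < M (i + k + 1)), M i != M (i + k) & M i != M (i + k + 1)].
  have lt_iN : i %% N < N by rewrite ltn_pmod.
  have := ast _ lt_iN; rewrite -/N !modnDml -addnA modnDml addnA.
  move=> [w0 [ws [/andP[ws0 path_ws] hd lst av]]].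
  have Ms p v w : same_edge p v w -> m p.1 p.2 = m v w.
    by case/orP => /eqP-> //=; rewrite /m minnC.
  have ne : 0 < size (walk_edges w0 ws) by rewrite size_zip leq_min /= lt0n size_eq0.
  have hdP : head (w0, w0) (walk_edges w0 ws) \in walk_edges w0 ws.
    by rewrite -nth0 mem_nth.
  have lstP : last (w0, w0) (walk_edges w0 ws) \in walk_edges w0 ws.
    by rewrite -nth_last mem_nth // prednK.
  have av_p p : p \in walk_edges w0 ws -> M i != m p.1 p.2.
    by move=> /(allP av); apply: avoids_neq_min.
  move: (av_p _ hdP) (av_p _ lstP) (avoids_walk_side (xy _ lt_iN) path_ws av hdP lstP).
  by rewrite (Ms _ _ _ hd) (Ms _ _ _ lst).
have MN i : M (i + N) = M i by rewrite /M modnDr.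
(* Advancing the index by [k + 1] negates [B]. After [N = 2k + 1] such steps, an odd number, the
   index has moved by a multiple of the period [N]. *)
pose B i := M i < M (i + k).
have flip i : B (i + k + 1) = ~~ B i.
  have [Bi _ neq] := side i; rewrite /B Bi (_ : i + k + 1 + k = i + N); last by rewrite /N; lia.
  by rewrite MN; lia.
have flips t : B (t * k.+1) = B 0 (+) odd t.
  elim: t => [|t IHt]; first by rewrite addbF.
  rewrite (_ : t.+1 * k.+1 = t * k.+1 + k + 1); last by rewrite mulSn; lia.
  by rewrite flip IHt /= addbN.
have BN t : B (N * t) = B 0.
  elim: t => [|t IHt]; first by rewrite muln0.
  by rewrite mulnS addnC -IHt /B MN addnAC MN.
by have := flips N; rewrite BN /N /= odd_double addbT; case: (B 0).
Qed.
End Order.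

End Asteroids.

Theorem theorem2 (T : finType) (e : rel T) (e_refl : reflexive e) (e_sym : symmetric e) :
  strong_cocomparability e <-> ~ has_weak_edge_asteroid e.
Proof.
split=> [[s [bij_s slash]]|no_asteroid].
  have [r sK rK] := bij_s.
  apply: (@order_no_asteroid _ _ e_refl e_sym (fun v => r v)).
    by move=> u v /val_inj; apply: (can_inj rK).
  move=> a b x y /and4P[/= ax by_ ay bx] ab; rewrite ltnNge; apply/negP => yx.
  apply: slash; exists (r a), (r b), (r y), (r x); rewrite !mxE !rK.
  split=> //; [|exact/negbTE|by split=> //; apply/negbTE].
  rewrite ltn_neqAle yx andbT; apply: contra ay => /eqP/val_inj/(can_inj rK)->.
  by [].
apply: (no_invertible_pair_order e_sym) => a b ab; apply/negP => inv.
by apply: no_asteroid; apply: invertible_pair_asteroid inv.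
Qed.
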